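(* Let $\mathbb{K}\in\{\mathbb{R},\mathbb{C}\}$, let $\Omega$ be a set and $\bm{\varphi}:\Omega\to\mathbb{K}^n$ a function. Let $\bm{I}_n\in\mathbb{K}^{n\times n}$ be the identity matrix. The following assertions are equivalent. (i) $\bm{I}_n\in\mathcal{C}_{\bm{\varphi}}:=\operatorname{cone}\{\bm{\varphi}(x)\bm{\varphi}(x)^\ast: x\in\Omega\}$. (ii) $\bm{I}_n\in\Delta_{\bm{\psi}}:=\operatorname{conv}\{\bm{\psi}(x)\bm{\psi}(x)^\ast: x\in\Omega\}$, with $\bm{\psi}$ the rescaling of $\bm{\varphi}$ defined in the context. (iii) If $N\ge\dim_{\mathbb{K}}\operatorname{lin}_{\mathbb{K}}\{\bm{\varphi}(x)\bm{\varphi}(x)^\ast: x\in\Omega\}+1$, then the matrix $\bm{I}_n$ is the unique maximizer $\bm{A}_{\kappa^\ast}$ of the determinant maximization problem $$\kappa^\ast=\operatorname*{arg\,max}_{\kappa\in\mathcal{K}_N}\det(\bm{A}_\kappa)$$ (i.e. the maximum over $\mathcal{K}_N$ is attained, and $\bm{A}_{\kappa^\ast}=\bm{I}_n$ for every maximizing $\kappa^\ast$).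
   Context: $\bm{v}^\ast=\overline{\bm{v}}^\top$; $\operatorname{lin}_{\mathbb{K}}$ is the $\mathbb{K}$-linear span; $\operatorname{cone}M:=\{\sum_{j=1}^m\lambda_jv_j: v_j\in M,\ \lambda_j\ge0,\ m\in\mathbb{N}\}$ and $\operatorname{conv}M$ is the convex hull of $M$. Define $\gamma_n(x):=\frac1n\|\bm{\varphi}(x)\|_2^2$, $\omega_n(x):=1/\gamma_n(x)$ if $\gamma_n(x)\neq0$ and $\omega_n(x):=0$ if $\gamma_n(x)=0$, and $\bm{\psi}(x):=\sqrt{\omega_n(x)}\,\bm{\varphi}(x)$ for $x\in\Omega$. For $N\in\mathbb{N}$ let $\mathcal{K}_N$ be the class of all weighted knots $\kappa=\{(x_j^{(\kappa)},\alpha_j^{(\kappa)})\}_{j=1}^N$ with $x_1^{(\kappa)},\ldots,x_N^{(\kappa)}\in\Omega$ (repetitions allowed), $\alpha_1^{(\kappa)},\ldots,\alpha_N^{(\kappa)}>0$ and $\sum_{j=1}^N\alpha_j^{(\kappa)}=1$. For $\kappa\in\mathcal{K}_N$ put $$\bm{A}_\kappa:=\sum_{j=1}^N\alpha_j^{(\kappa)}\,\bm{\psi}(x_j^{(\kappa)})\bm{\psi}(x_j^{(\kappa)})^\ast.$$ *)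

(* Defs.v *)
From HB Require Import structures.
From mathcomp Require Import all_boot all_order all_algebra.
From mathcomp Require Import classical_sets boolp reals.
From mathcomp Require Import complex.

Set Implicit Arguments.
Unset Strict Implicit.
Unset Printing Implicit Defensive.

Import Order.TTheory GRing.Theory Num.Theory.

Local Open Scope classical_set_scope.
Local Open Scope ring_scope.

(** The scalar field is one of [R] and [R[i]], where [R : realType] is the
    field of real numbers. Quantities that are real in either case (moduli,
    [gamma], [omega], weights, coefficients of cones and convex hulls) are
    elements of [R], mapped into the scalar field by [of_real]. *)

Variant base_field := RealField | ComplexField.

Definition scalar_field (R : realType) (k : base_field) : numFieldType :=
  match k with
  | RealField => R : numFieldType
  | ComplexField => R[i] : numFieldType
  end.

Definition of_real (R : realType) (k : base_field) : R -> scalar_field R k :=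
  match k return R -> scalar_field R k with
  | RealField => fun a => a
  | ComplexField => fun a => (a%:C)%C
  end.

Definition conj_scalar (R : realType) (k : base_field) :
    scalar_field R k -> scalar_field R k :=
  match k return scalar_field R k -> scalar_field R k with
  | RealField => fun a => a
  | ComplexField => fun z => (z^*)%C
  end.

Definition modulus (R : realType) (k : base_field) : scalar_field R k -> R :=
  match k return scalar_field R k -> R with
  | RealField => fun a => `|a|
  | ComplexField => fun z => ComplexField.Normc.normc z
  end.

Arguments of_real {R} k a.
Arguments conj_scalar {R} k z.
Arguments modulus {R} k z.

Section LinearSpan.
Variables (K : fieldType) (V : vectType K).
Implicit Types (M : set V) (v : V).

Definition lin_comb M : set V :=
  [set v | exists (m : nat) (c : 'I_m -> K) (w : 'I_m -> V),
     (forall j, M (w j)) /\ v = \sum_(j < m) c j *: w j].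

(** The span of an arbitrary, possibly infinite, set as a [{vspace V}], so that
    its dimension is [\dim (lin_span M)]; the default value of [xget] is never
    used, by [lin_spanP]. *)
Definition lin_span M : {vspace V} :=
  xget 0%VS [set U : {vspace V} | forall v, v \in U <-> lin_comb M v].

Lemma lin_spanP M v : v \in lin_span M <-> lin_comb M v.
Proof.
suff [U hU] : exists U : {vspace V}, forall v, v \in U <-> lin_comb M v.
  by rewrite /lin_span; case: xgetP => [W _ hW|/(_ U)] //; apply: hW.
pose P d :=
  `[< exists X : seq V, (forall x, x \in X -> M x) /\ \dim <<X>>%VS = d >].
have exP : exists d, P d.
  by exists (\dim <<[::] : seq V>>%VS); apply/asboolP; exists [::].
have ubP d : P d -> (d <= \dim {:V})%N.
  by move=> /asboolP[X [_ <-]]; apply/dimvS/subvf.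
case: (ex_maxnP exP ubP) => d /asboolP[X [XM dX]] maxd.
have MX x : M x -> x \in <<X>>%VS.
  move=> Mx; have sXx : (<<X>> <= <<x :: X>>)%VS by rewrite span_cons addvSr.
  have dle : (\dim <<x :: X>>%VS <= \dim <<X>>%VS)%N.
    rewrite dX; apply: maxd; apply/asboolP; exists (x :: X); split=> // y.
    by rewrite inE => /predU1P[->|/XM].
  have /eqP -> : (<<X>> == <<x :: X>>)%VS by rewrite eqEdim sXx.
  by rewrite memv_span ?mem_head.
exists <<X>>%VS => u; split=> [uX|[m [c [w [Mw ->]]]]].
  exists (size X), (fun j => coord (in_tuple X) j u), (fun j => X`_j); split.
    by move=> j; apply/XM/mem_nth.
  exact: (@coord_span _ _ _ (in_tuple X)).
by apply: memv_suml => j _; apply/memvZ/MX.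
Qed.

End LinearSpan.

Section Hulls.
Variables (R : realType) (k : base_field) (V : lmodType (scalar_field R k)).

Definition cone (M : set V) : set V :=
  [set v | exists (m : nat) (lambda : 'I_m -> R) (w : 'I_m -> V),
     [/\ forall j, M (w j), forall j, 0 <= lambda j
       & v = \sum_(j < m) of_real k (lambda j) *: w j]].

Definition conv_hull (M : set V) : set V :=
  [set v | exists (m : nat) (lambda : 'I_m -> R) (w : 'I_m -> V),
     [/\ forall j, M (w j), forall j, 0 <= lambda j,
         \sum_(j < m) lambda j = 1
       & v = \sum_(j < m) of_real k (lambda j) *: w j]].

End Hulls.

Section Rescaling.
Variables (R : realType) (k : base_field) (n : nat).

Definition adjoint (v : 'cV[scalar_field R k]_n) : 'rV[scalar_field R k]_n :=
  (map_mx (conj_scalar k) v)^T.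

Definition norm2 (v : 'cV[scalar_field R k]_n) : R :=
  Num.sqrt (\sum_(i < n) modulus k (v i 0) ^+ 2).

Variables (Omega : Type) (phi : Omega -> 'cV[scalar_field R k]_n).

Definition dyads : set 'M[scalar_field R k]_n :=
  [set A | exists x : Omega, A = phi x *m adjoint (phi x)].

Definition gamma (x : Omega) : R := n%:R^-1 * norm2 (phi x) ^+ 2.

Definition omega (x : Omega) : R :=
  if gamma x != 0 then (gamma x)^-1 else 0.

Definition psi (x : Omega) : 'cV[scalar_field R k]_n :=
  of_real k (Num.sqrt (omega x)) *: phi x.

End Rescaling.

Record weighted_knot (R : realType) (Omega : Type) (N : nat) := WeightedKnot {
  node : 'I_N -> Omega;
  weight : 'I_N -> R;
  weight_gt0 : forall j, 0 < weight j;
  weight_sum1 : \sum_(j < N) weight j = 1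
}.

Section DetMax.
Variables (R : realType) (k : base_field) (n : nat) (Omega : Type).
Variables (phi : Omega -> 'cV[scalar_field R k]_n) (N : nat).

Definition knot_mx (kappa : weighted_knot R Omega N) : 'M[scalar_field R k]_n :=
  \sum_(j < N) of_real k (weight kappa j) *:
    (psi phi (node kappa j) *m adjoint (psi phi (node kappa j))).

(** The matrices [knot_mx kappa] are Hermitian, so their determinants are real
    and the order of [scalar_field R k], which for [R[i]] compares numbers with
    equal imaginary parts by their real parts, is the real one on them. *)
Definition det_maximizer (kappa : weighted_knot R Omega N) : Prop :=
  forall kappa' : weighted_knot R Omega N,
    \det (knot_mx kappa') <= \det (knot_mx kappa).

End DetMax.

(* Main.v *)
From HB Require Import structures.
Require Import Defs.
From mathcomp Require Import all_boot all_order all_algebra.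
From mathcomp Require Import classical_sets boolp reals.
From mathcomp Require Import complex.

Set Implicit Arguments.
Unset Strict Implicit.
Unset Printing Implicit Defensive.

Import Order.TTheory GRing.Theory Num.Theory.

Local Open Scope classical_set_scope.
Local Open Scope ring_scope.

(** Write [F x] for the dyad of [psi x]. It is a nonnegative multiple of the
    dyad of [phi x], and conversely, and the scaling is chosen so that its trace
    is [n] unless [phi x = 0], in which case [F x = 0].

    Cone and convex hull. The identity has trace [n]. Comparing traces in an
    expression of [1%:M] as a nonnegative combination of the [F x], with
    coefficient [0] at the zero dyads, shows that the coefficients add up to [1]
    ([psi_weights_sum1]): every conic combination that equals the identity is
    already convex.

    Maximal determinant. A knot matrix is positive semidefinite, Hermitian, of
    trace at most [n]. The arithmetic-geometric mean inequality for its
    eigenvalues bounds its determinant by [1], with equality only at the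
    identity ([det_psd_le1], [det_knot_mx_le1]). Hence, as soon as the identity
    is a knot matrix, the knots realizing it are exactly the maximizers.

    Length of knots. It remains to write the identity with exactly [N] strictly
    positive weights ([exists_knot_mx1]). Caratheodory's reduction for cones
    ([caratheodory]) brings the number of terms down to the dimension of the
    span of the dyads; the trace argument restores the total weight [1], and
    halving weights repeats nodes until there are [N] of them ([pad_weights]).
    That the reduction stops at the dimension of the span over the scalar field,
    although it needs real coefficients, is due to dyads being Hermitian: the
    real and imaginary parts of a linear relation between Hermitian matrices are
    again linear relations ([real_dependence]).

    Conversely, any knot matrix is a conic combination of dyads of [phi], so the
    identity lies in the cone as soon as it is the matrix of a maximizer. *)

(** * Determinant and trace of positive semidefinite matrices *)

Section DetBound.
Local Open Scope sesquilinear_scope.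
Variables (C : numClosedFieldType).

(** For the eigenvalues [d], the mean inequality gives
    [\det A = \prod d <= mu ^+ n], where [mu = \tr A / n <= 1]. Equality of both
    with [1] makes the eigenvalues equal to one another and [mu = 1], so that
    the diagonal form of [A] is the identity. *)
Lemma det_psd_le1 n (A : 'M[C]_n) :
    A \is hermsymmx -> (forall u : 'rV_n, 0 <= (u *m A *m u ^t* ) 0 0) ->
    \tr A <= n%:R ->
  \det A <= 1 ?= iff (A == 1%:M).
Proof.
case: n A => [|n] A herA psdA trA.
  by rewrite det_mx00 (flatmx0 A) (flatmx0 1%:M) eqxx; apply/leif_refl.
have /orthomx_spectralP := hermitian_normalmx herA.
set P := spectralmx A; set d := spectral_diag A => eqA.
have unitP : P \in unitmx by apply: spectral_unit.
have d_ge0 i : 0 <= d 0 i.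
  suff -> : d 0 i = (row i P *m A *m (row i P) ^t* ) 0 0 by apply: psdA.
  rewrite -row_mul eqA !mulmxA mulmxV // mul1mx.
  transitivity ((diag_mx d *m P *m P ^t* ) i i).
    rewrite -mulmxA (unitarymxP (spectral_unitarymx A)) mulmx1.
    by rewrite !mxE eqxx.
  by rewrite !mxE; apply: eq_bigr => j _; rewrite !mxE.
have detA : \det A = \prod_i d 0 i.
  rewrite eqA !det_mulmx mulrC mulrA -det_mulmx mulmxV // det1 mul1r.
  by rewrite det_diag.
have trAE : \tr A = \sum_i d 0 i.
  by rewrite eqA -mulmxA mxtrace_mulC -mulmxA mulmxV // mulmx1 mxtrace_diag.
pose mu := \tr A / n.+1%:R.
have mu_ge0 : 0 <= mu by rewrite divr_ge0 ?ler0n // trAE sumr_ge0.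
have mu_le1 : mu <= 1 by rewrite ler_pdivrMr ?ltr0Sn // mul1r.
have muX : mu ^+ n.+1 <= 1 ?= iff (mu == 1).
  by split; [rewrite exprn_ile1 | rewrite pexpr_eq1].
have agm := @leif_AGM C 'I_n.+1 predT (d 0) (in1W d_ge0).
rewrite /= card_ord -trAE -detA -/mu in agm.
have := leif_trans agm muX; congr (_ <= _ ?= iff _).
apply/andP/eqP => [[/forall_inP d_const /eqP mu1]|A1]; last first.
  have mu1 : mu = 1 by rewrite /mu A1 mxtrace1 divff ?pnatr_eq0.
  split; last by rewrite mu1.
  by rewrite -agm mu1 expr1n A1 det1.
have d1 i : d 0 i = 1.
  have sumd : \sum_j d 0 j = n.+1%:R * d 0 i.
    rewrite mulr_natl (eq_bigr (fun=> d 0 i)) ?sumr_const ?card_ord // => j _.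
    exact/eqP/(forall_inP (d_const j isT)).
  by move: mu1; rewrite /mu trAE sumd mulrAC divff ?pnatr_eq0 // mul1r.
rewrite eqA (_ : d = const_mx 1) ?diag_const_mx ?mulmx1 ?mulVmx //.
by apply/rowP => i; rewrite d1 mxE.
Qed.

End DetBound.

(** * The scalar field *)

Section Scalars.
Variables (R : realType) (k : base_field).
Local Notation K := (scalar_field R k).

Fact of_real_is_additive : zmod_morphism (of_real k : R -> K).
Proof. by case: k => //= x y; rewrite rmorphB. Qed.
Fact of_real_is_multiplicative : monoid_morphism (of_real k : R -> K).
Proof. by case: k => //=; split=> [|x y]; rewrite ?rmorph1 ?rmorphM. Qed.
HB.instance Definition _ := GRing.isZmodMorphism.Build R K (of_real k)
  of_real_is_additive.
HB.instance Definition _ := GRing.isMonoidMorphism.Build R K (of_real k)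
  of_real_is_multiplicative.

Fact conj_scalar_is_additive : zmod_morphism (conj_scalar k : K -> K).
Proof. by case: k => //= x y; rewrite rmorphB. Qed.
Fact conj_scalar_is_multiplicative : monoid_morphism (conj_scalar k : K -> K).
Proof. by case: k => //=; split=> [|x y]; rewrite ?rmorph1 ?rmorphM. Qed.
HB.instance Definition _ := GRing.isZmodMorphism.Build K K (conj_scalar k)
  conj_scalar_is_additive.
HB.instance Definition _ := GRing.isMonoidMorphism.Build K K (conj_scalar k)
  conj_scalar_is_multiplicative.

Lemma conj_scalarK : involutive (conj_scalar k : K -> K).
Proof. by case: k => //=; apply: conjcK. Qed.

Lemma conj_of_real (a : R) : conj_scalar k (of_real k a) = of_real k a.
Proof. by case: k => //=; apply: conjc_real. Qed.

Lemma ler_of_real (a b : R) : (of_real k a <= of_real k b) = (a <= b).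
Proof. by case: k => //=; apply: lecR. Qed.

Lemma of_real_inj : injective (of_real k : R -> K).
Proof. by case: k => //= x y []. Qed.

Lemma mul_conj_scalar (z : K) :
  z * conj_scalar k z = of_real k (modulus k z ^+ 2).
Proof.
case: k z => /= z; first by rewrite real_normK ?num_real.
by rewrite -sqr_normc rmorphXn.
Qed.

(** The spectral theorem holds over a closed field; this embedding brings
    matrices over either scalar field under it. *)
Definition complexify : K -> R[i] :=
  match k return scalar_field R k -> R[i] with
  | RealField => fun a => (a%:C)%C
  | ComplexField => fun z => z
  end.

Fact complexify_is_additive : zmod_morphism complexify.
Proof. by rewrite /complexify; case: k => //= x y; rewrite rmorphB. Qed.
Fact complexify_is_multiplicative : monoid_morphism complexify.
Proof.
rewrite /complexify; case: k => //=; split=> [|x y].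
  exact: rmorph1.
exact: rmorphM.
Qed.
HB.instance Definition _ := GRing.isZmodMorphism.Build K R[i] complexify
  complexify_is_additive.
HB.instance Definition _ := GRing.isMonoidMorphism.Build K R[i] complexify
  complexify_is_multiplicative.

Lemma complexify_conj (z : K) : complexify (conj_scalar k z) = (complexify z)^*.
Proof. by rewrite /complexify; case: k z => //= z; apply/esym/conjc_real. Qed.

Lemma complexify_of_real (a : R) : complexify (of_real k a) = (a%:C)%C.
Proof. by rewrite /complexify; case: k. Qed.

Lemma ler_complexify : {mono complexify : x y / x <= y}.
Proof. by rewrite /complexify; case: k => //= x y; rewrite lecR. Qed.

(** * Real linear relations and Caratheodory's theorem *)

(** Transposing and conjugating a relation with coefficients [c] between
    Hermitian matrices gives the relation with the conjugate coefficients, so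
    the real and the imaginary parts of [c] are relations as well, and one of
    them is nonzero. A change of sign provides a positive coefficient. *)
Lemma real_dependence n m (A : 'I_m -> 'M[K]_n) (c : 'I_m -> K) :
    (forall j, map_mx (conj_scalar k) (A j)^T = A j) ->
    \sum_j c j *: A j = 0 -> (exists j, c j != 0) ->
  exists2 r : 'I_m -> R, exists j, 0 < r j & \sum_j of_real k (r j) *: A j = 0.
Proof.
move=> herA sumA [i ci].
suff [r [l rl] sumr] : exists2 r : 'I_m -> R, exists j, r j != 0
    & \sum_j of_real k (r j) *: A j = 0.
  move: rl; case: (ltgtP (r l) 0) => // rl _; last by exists r; first exists l.
  exists (fun j => - r j); first by exists l; rewrite oppr_gt0.
  by under eq_bigr do rewrite rmorphN scaleNr; rewrite sumrN sumr oppr0.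
have sumAc : \sum_j conj_scalar k (c j) *: A j = 0.
  have := congr1 (fun B : 'M_n => map_mx (conj_scalar k) B^T) sumA.
  rewrite trmx0 map_mx0 linear_sum raddf_sum => sum0; rewrite -[RHS]sum0.
  by apply: eq_bigr => j _; rewrite linearZ /= map_mxZ herA.
case: k A c herA sumA ci sumAc => /= A c herA sumA ci sumAc.
  by exists c => //; exists i.
have sumRe : \sum_j ((complex.Re (c j))%:C)%C *: A j = 0.
  under eq_bigr do rewrite ReJ_add mulrC -scalerA scalerDl.
  by rewrite -scaler_sumr big_split /= sumA sumAc addr0 scaler0.
have sumIm : \sum_j ((complex.Im (c j))%:C)%C *: A j = 0.
  under eq_bigr do rewrite ImJ_sub -mulrA mulrC -scalerA scalerBl.
  rewrite -scaler_sumr big_split /= sumrN.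
  by rewrite sumA sumAc subr0 scaler0.
have [Re0|Re_neq0] := eqVneq (complex.Re (c i)) 0.
  exists (fun j => complex.Im (c j)) => //; exists i.
  by apply: contra ci => /eqP Im0; rewrite eq_complex Re0 Im0 /= !eqxx.
by exists (fun j => complex.Re (c j)) => //; exists i.
Qed.

Definition weighted_sum (T : Type) (V : lmodType K) (F : T -> V)
    (s : seq (R * T)) : V :=
  \sum_(p <- s) of_real k p.1 *: F p.2.

Definition positive_weights (T : Type) (s : seq (R * T)) : bool :=
  all (fun p => 0 < p.1) s.

Lemma weighted_sum_filter_gt0 T (V : lmodType K) (F : T -> V)
    (s : seq (R * T)) :
    all (fun p => 0 <= p.1) s ->
  weighted_sum F [seq p <- s | 0 < p.1] = weighted_sum F s.
Proof.
rewrite /weighted_sum; elim: s => //= p s IHs /andP[p_ge0 s_ge0].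
case: ltgtP p_ge0 => // [p_gt0|p0] _; rewrite !big_cons IHs //.
by rewrite -p0 rmorph0 scale0r add0r.
Qed.

(** Subtract the largest multiple [t] of a real relation [r] that keeps the
    weights nonnegative: at least one weight vanishes. *)
Lemma caratheodory_step n (T : Type) (F : T -> 'M[K]_n) (U : {vspace 'M[K]_n})
    (s : seq (R * T)) :
    (forall x, map_mx (conj_scalar k) (F x)^T = F x) -> (forall x, F x \in U) ->
    positive_weights s -> (\dim U < size s)%N ->
  exists s', [/\ positive_weights s', (size s' < size s)%N
               & weighted_sum F s' = weighted_sum F s].
Proof.
move=> herF FU s_gt0 ltUs.
pose a j := (tnth (in_tuple s) j).1; pose x j := (tnth (in_tuple s) j).2.
pose X := [tuple F (x j) | j < size s].
have XE (j : 'I_(size s)) : X`_j = F (x j) by rewrite -tnth_nth tnth_mktuple.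
have notfreeX : ~~ free X.
  apply/negP => /eqP; rewrite size_tuple => dimX.
  suff : (\dim <<X>> <= \dim U)%N by rewrite dimX leqNgt ltUs.
  by apply/dimvS/span_subvP => _ /mapP[j _ ->].
have [r [l rl] sumr] : exists2 r : 'I_(size s) -> R, exists j, 0 < r j
    & \sum_j of_real k (r j) *: F (x j) = 0.
  have [c sumc [i ci]] : exists2 c : 'I_(size s) -> K,
      \sum_j c j *: F (x j) = 0 & exists j, c j != 0.
    apply: contrapT => noc; move/negP: notfreeX; apply; apply/freeP => c sumc i.
    apply/eqP; apply: contrapT => /negP ci; apply: noc.
    exists c; last by exists i.
    by rewrite -[RHS]sumc; apply: eq_bigr => j _; rewrite XE.
  by apply: real_dependence sumc _ => //; exists i.
have a_gt0 j : 0 < a j by exact: (all_tnthP (t := in_tuple s) s_gt0).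
case: (@arg_minP _ _ _ l (fun j => 0 < r j) (fun j => a j / r j) rl).
move=> m rm minm.
pose t := a m / r m.
have t_ge0 : 0 <= t by rewrite divr_ge0 ?ltW.
pose b j := a j - t * r j.
have b_ge0 j : 0 <= b j.
  rewrite subr_ge0; have [rj|rj] := ltP 0 (r j).
    by rewrite -ler_pdivlMr //; apply: minm.
  by apply: le_trans (ltW (a_gt0 j)); rewrite mulr_ge0_le0.
have bm : b m = 0 by rewrite /b /t divfK ?subrr // gt_eqF.
pose s1 := [seq (b j, x j) | j <- enum 'I_(size s)].
exists [seq p <- s1 | 0 < p.1]; split.
- exact: filter_all.
- rewrite size_filter -[ltnRHS]size_enum_ord.
  rewrite -[ltnRHS](size_map (fun j => (b j, x j))).
  rewrite -/s1 -(count_predC (fun p : R * T => 0 < p.1) s1).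
  rewrite -[ltnLHS]addn0 ltn_add2l -has_count has_map.
  by apply/hasP; exists m; [exact: mem_enum | rewrite /= bm ltxx].
- rewrite weighted_sum_filter_gt0; last first.
    by rewrite all_map; apply/allP => j _; apply: b_ge0.
  rewrite /weighted_sum [RHS]big_tnth big_map big_enum /=.
  under eq_bigr do rewrite rmorphB rmorphM scalerBl -scalerA.
  by rewrite sumrB -scaler_sumr sumr scaler0 subr0.
Qed.

(** The Hermitian hypothesis is what allows the bound to be a dimension over
    the scalar field: for arbitrary complex matrices it would have to be the
    dimension over the real numbers, up to twice as large. *)
Lemma caratheodory n (T : Type) (F : T -> 'M[K]_n) (U : {vspace 'M[K]_n})
    (s : seq (R * T)) :
    (forall x, map_mx (conj_scalar k) (F x)^T = F x) -> (forall x, F x \in U) ->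
    positive_weights s ->
  exists s', [/\ positive_weights s', (size s' <= \dim U)%N
               & weighted_sum F s' = weighted_sum F s].
Proof.
move=> herF FU; have [m] := ubnP (size s); elim: m s => // m IHm s sm s_gt0.
have [leUs|ltUs] := leqP (size s) (\dim U); first by exists s.
have [s1 [s1_gt0 ltss1 <-]] := caratheodory_step herF FU s_gt0 ltUs.
by apply: IHm s1_gt0; apply: leq_trans ltss1 _.
Qed.

(** Splitting a term into two halves at the same node lengthens the list by one
    and changes neither sum. *)
Lemma pad_weights (T : Type) (V : lmodType K) (F : T -> V) (s : seq (R * T)) N :
    positive_weights s -> (0 < size s <= N)%N ->
  exists s', [/\ positive_weights s', size s' = N,
                 \sum_(p <- s') p.1 = \sum_(p <- s) p.1
               & weighted_sum F s' = weighted_sum F s].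
Proof.
move=> + /andP[+ leN]; rewrite -(subnK leN); move: (N - _)%N => m {leN}.
elim: m s => [|m IHm] [//|[a x] s] /andP[/= a_gt0 s_gt0] _.
  by exists ((a, x) :: s); split=> //; rewrite /positive_weights /= a_gt0.
have [|//|s1 [s1_gt0 s1m sum1 wsum1]] := IHm [:: (a / 2, x), (a / 2, x) & s].
  by rewrite /positive_weights /= divr_gt0.
exists s1; split=> //; first by rewrite s1m /= !addnS addSn.
  by rewrite sum1 !big_cons /= addrA -splitr.
rewrite wsum1 /weighted_sum !big_cons /= addrA -scalerDl.
by rewrite -rmorphD -splitr.
Qed.

(** * Dyads and their positive combinations *)

Section Dyads.
Variable n : nat.
Implicit Types u v : 'cV[K]_n.

Lemma dyad_hermitian v :
  map_mx (conj_scalar k) (v *m adjoint v)^T = v *m adjoint v.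
Proof.
rewrite trmx_mul map_mxM /adjoint trmxK; congr (_ *m _).
  by apply/matrixP=> i j; rewrite !mxE; apply: conj_scalarK.
by rewrite map_trmx.
Qed.

Lemma mxtrace_dyad v : \tr (v *m adjoint v) = of_real k (norm2 v ^+ 2).
Proof.
rewrite mxtrace_mulC trace_mx11 mxE sqr_sqrtr; last first.
  by apply: sumr_ge0 => i _; apply: sqr_ge0.
rewrite rmorph_sum; apply: eq_bigr => i _.
by rewrite !mxE mulrC mul_conj_scalar.
Qed.

Lemma norm2_eq0 v : norm2 v = 0 -> v = 0.
Proof.
move=> /eqP; rewrite sqrtr_eq0 => norm_le0; apply/colP => i; rewrite mxE.
have mod0 : modulus k (v i 0) ^+ 2 = 0.
  apply/eqP; rewrite eq_le sqr_ge0 andbT; apply: le_trans norm_le0.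
  by rewrite (bigD1 i) //= lerDl sumr_ge0 // => j _; apply: sqr_ge0.
have := mul_conj_scalar (v i 0); rewrite mod0 rmorph0 => /eqP.
rewrite mulf_eq0 => /orP[/eqP //|/eqP].
by move/(congr1 (conj_scalar k)); rewrite conj_scalarK rmorph0.
Qed.

Lemma dyadZ (a : R) v :
  (of_real k a *: v) *m adjoint (of_real k a *: v)
  = of_real k (a ^+ 2) *: (v *m adjoint v).
Proof.
rewrite /adjoint map_mxZ /= conj_of_real linearZ /= -scalemxAl -scalemxAr.
by rewrite scalerA expr2 rmorphM.
Qed.

(** Such a combination is positive semidefinite: over the complex numbers its
    Hermitian form takes at [u] the value [\sum_i a i * `|u *m v i| ^+ 2]. *)
Lemma det_sum_dyads_le1 (I : finType) (a : I -> R) (v : I -> 'cV[K]_n)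
    (A := \sum_i of_real k (a i) *: (v i *m adjoint (v i))) :
    (forall i, 0 <= a i) -> \tr A <= n%:R ->
  \det A <= 1 ?= iff (A == 1%:M).
Proof.
move=> a_ge0 trA.
pose B := map_mx complexify A.
have BE : B = \sum_i (a i)%:C%C *: (map_mx complexify (v i)
    *m map_mx Num.conj (map_mx complexify (v i))^T).
  rewrite /B raddf_sum; apply: eq_bigr => i _ /=.
  rewrite map_mxZ map_mxM /= complexify_of_real; congr (_ *: (_ *m _)).
  by apply/matrixP => j l; rewrite !mxE complexify_conj.
suff : \det B <= 1 ?= iff (B == 1%:M).
  rewrite /B det_map_mx -(map_mx1 complexify).
  rewrite (inj_eq (@map_mx_inj _ _ complexify _ _)).
  case=> le1 eq1; split; first by rewrite -ler_complexify rmorph1.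
  by rewrite -eq1 -(inj_eq (fmorph_inj complexify)) rmorph1.
pose w i := map_mx complexify (v i).
apply: det_psd_le1.
- apply/is_hermitianmxP; rewrite expr0 scale1r BE !raddf_sum /=.
  apply: eq_bigr => i _; rewrite linearZ /= map_mxZ trmx_mul map_mxM /=.
  by rewrite trmxCK [Num.conj _](conjc_real (a i)).
- move=> u; rewrite BE mulmx_sumr mulmx_suml summxE sumr_ge0 // => i _.
  rewrite -scalemxAr -scalemxAl mxE mulr_ge0 ?ler0c //.
  have -> : u *m (w i *m map_mx Num.conj (w i)^T) *m map_mx Num.conj u^T
    = (u *m w i) *m map_mx Num.conj (u *m w i)^T.
    by rewrite trmx_mul map_mxM !mulmxA.
  by move: (u *m _) => z; rewrite mxE big_ord1 !mxE mul_conjC_ge0.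
- by rewrite /B trace_map_mx -(rmorph_nat complexify) ler_complexify.
Qed.

End Dyads.

(** * The rescaled dyads *)

Section Psi.
Variables (n : nat) (Omega : Type) (phi : Omega -> 'cV[K]_n).

Lemma gamma_ge0 x : 0 <= gamma phi x.
Proof. by rewrite mulr_ge0 ?invr_ge0 ?ler0n ?sqr_ge0. Qed.

Lemma omega_ge0 x : 0 <= omega phi x.
Proof. by rewrite /omega; case: ifP => // _; rewrite invr_ge0 gamma_ge0. Qed.

Lemma psi_dyad x :
  psi phi x *m adjoint (psi phi x)
  = of_real k (omega phi x) *: (phi x *m adjoint (phi x)).
Proof. by rewrite dyadZ sqr_sqrtr ?omega_ge0. Qed.

Lemma phi_eq0 x : (0 < n)%N -> gamma phi x = 0 -> phi x = 0.
Proof.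
move=> n_gt0 /eqP; rewrite mulf_eq0 invr_eq0 pnatr_eq0 gtn_eqF //= expf_eq0 /=.
by move=> /eqP; apply: norm2_eq0.
Qed.

Lemma phi_dyad x : (0 < n)%N ->
  phi x *m adjoint (phi x)
  = of_real k (gamma phi x) *: (psi phi x *m adjoint (psi phi x)).
Proof.
move=> n_gt0; rewrite psi_dyad scalerA -rmorphM /omega.
have [/(phi_eq0 n_gt0) ->|gx] := eqVneq (gamma phi x) 0.
  by rewrite mul0mx scaler0.
by rewrite divff // rmorph1 scale1r.
Qed.

Lemma mxtrace_psi x : (0 < n)%N ->
  \tr (psi phi x *m adjoint (psi phi x))
  = of_real k (if gamma phi x == 0 then 0 else n%:R).
Proof.
move=> n_gt0; rewrite psi_dyad mxtraceZ mxtrace_dyad -rmorphM /omega.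
case: eqP => [_|/eqP gx] /=; first by rewrite mul0r.
rewrite [gamma phi x]/gamma invfM invrK mulfVK //.
by apply: contra gx; rewrite /gamma => /eqP ->; rewrite mulr0.
Qed.

(** Comparison of traces: each [psi] dyad with a nonzero coefficient has trace
    [n], and so does the identity. *)
Lemma psi_weights_sum1 (I : Type) (r : seq I) (P : pred I) (a : I -> R)
    (x : I -> Omega) : (0 < n)%N ->
    (forall i, P i -> gamma phi (x i) = 0 -> a i = 0) ->
    \sum_(i <- r | P i) of_real k (a i) *:
      (psi phi (x i) *m adjoint (psi phi (x i))) = 1%:M ->
  \sum_(i <- r | P i) a i = 1.
Proof.
move=> n_gt0 a0 /(congr1 (fun A : 'M_n => \tr A)).
rewrite mxtrace1 raddf_sum /=.
under eq_bigr => i Pi.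
  rewrite mxtraceZ mxtrace_psi // -rmorphM.
  rewrite (_ : a i * _ = a i * n%:R); last first.
    by case: eqP => // /(a0 i Pi) ->; rewrite !mul0r.
  over.
have n_neq0 : n%:R != 0 :> R by rewrite pnatr_eq0 -lt0n.
rewrite -raddf_sum -mulr_suml -(rmorph_nat (of_real k)) => /of_real_inj.
by move/(canRL (mulfK n_neq0)); rewrite divff.
Qed.

(** The weights add up to [1] and the dyads have trace [0] or [n], so the trace
    is at most [n]. *)
Lemma det_knot_mx_le1 N (kappa : weighted_knot R Omega N) : (0 < n)%N ->
  \det (knot_mx phi kappa) <= 1 ?= iff (knot_mx phi kappa == 1%:M).
Proof.
move=> n_gt0; apply: det_sum_dyads_le1 => [j|]; first exact/ltW/weight_gt0.
rewrite raddf_sum /=.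
under eq_bigr do rewrite mxtraceZ mxtrace_psi // -rmorphM.
rewrite -raddf_sum -(rmorph_nat (of_real k)) ler_of_real.
have sum_n : \sum_j weight kappa j * n%:R = n%:R.
  by rewrite -mulr_suml weight_sum1 mul1r.
rewrite -[leRHS]sum_n; apply: ler_sum => j _.
apply: ler_wpM2l; first exact/ltW/weight_gt0.
by case: ifP => // _; apply: ler0n.
Qed.

(** The reduction only preserves the sum, so nodes where [psi] vanishes are
    removed and the total weight is recomputed from the trace before nodes are
    repeated. *)
Lemma exists_knot_mx1 (s : seq (R * Omega)) N : (0 < n)%N ->
    (\dim (lin_span (dyads phi)) <= N)%N -> all (fun p => 0 <= p.1) s ->
    weighted_sum (fun x => psi phi x *m adjoint (psi phi x)) s = 1%:M ->
  exists kappa : weighted_knot R Omega N, knot_mx phi kappa = 1%:M.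
Proof.
move=> n_gt0 ledN s_ge0; set F : Omega -> 'M_n := fun x => _; move=> sum1.
have psi_in_span x : F x \in lin_span (dyads phi).
  rewrite /F psi_dyad memvZ //; apply/lin_spanP.
  exists 1%N, (fun=> 1), (fun=> phi x *m adjoint (phi x)); split.
    by move=> _; exists x.
  by rewrite big_ord1 scale1r.
have F_herm x := dyad_hermitian (psi phi x).
have [s1 [s1_gt0 les1]] := caratheodory F_herm psi_in_span (filter_all _ s).
rewrite weighted_sum_filter_gt0 // {}sum1 => sum1.
pose s2 := [seq p <- s1 | gamma phi p.2 != 0].
have s2_gt0 : positive_weights s2.
  rewrite /positive_weights all_filter.
  by apply: sub_all s1_gt0 => p /= ->; rewrite implybT.
have sum2 : weighted_sum F s2 = 1%:M.
  rewrite -sum1 /weighted_sum big_filter big_rmcond // => p.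
  rewrite negbK /F => /eqP g0.
  by rewrite psi_dyad /omega g0 eqxx rmorph0 scale0r scaler0.
have weights2 : \sum_(p <- s2) p.1 = 1.
  move: sum2; rewrite /weighted_sum !big_filter.
  by apply: psi_weights_sum1 => // p /eqP.
have size2 : (0 < size s2 <= N)%N.
  rewrite (leq_trans _ ledN) ?andbT; last first.
    by apply: leq_trans les1; rewrite size_filter count_size.
  rewrite lt0n; apply: contra_eq_neq weights2 => /size0nil ->.
  by rewrite big_nil eq_sym oner_eq0.
have [s3 [s3_gt0 s3N weights3 sum3]] := pad_weights F s2_gt0 size2.
move: s3N s3_gt0 weights3 sum3 => /eqP s3N; rewrite -[s3]/(val (Tuple s3N)).
move: (Tuple s3N) => t t_gt0; rewrite weights2 sum2 => weights3 sum3.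
have weights_gt0 j : 0 < (tnth t j).1 by exact: (all_tnthP t_gt0).
have weights_sum : \sum_j (tnth t j).1 = 1 by rewrite -weights3 [RHS]big_tuple.
exists (WeightedKnot (fun j => (tnth t j).2) weights_gt0 weights_sum).
by rewrite -sum3 /knot_mx /weighted_sum [RHS]big_tuple.
Qed.

End Psi.
End Scalars.

(** * The equivalence *)

Theorem theorem7p4 (R : realType) (k : base_field) (n : nat) (Omega : Type)
    (phi : Omega -> 'cV[scalar_field R k]_n) (n_gt0 : (0 < n)%N) :
  [<-> cone (dyads phi) 1%:M;
       conv_hull (dyads (psi phi)) 1%:M;
       forall N : nat, (\dim (lin_span (dyads phi)) + 1 <= N)%N ->
         (exists kappa : weighted_knot R Omega N, det_maximizer phi kappa) /\
         (forall kappa : weighted_knot R Omega N,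
            det_maximizer phi kappa -> knot_mx phi kappa = 1%:M)].
Proof.
tfae.
- case=> m [a [w [/fin_all_exists[x wE] a_ge0 sumA]]].
  pose b j := a j * gamma phi (x j).
  have sumB : \sum_j of_real k (b j) *:
      (psi phi (x j) *m adjoint (psi phi (x j))) = 1%:M.
    rewrite sumA; apply: eq_bigr => j _.
    by rewrite wE (phi_dyad phi) // scalerA -rmorphM.
  exists m, b, (fun j => psi phi (x j) *m adjoint (psi phi (x j))); split=> //.
  + by move=> j; exists (x j).
  + by move=> j; rewrite mulr_ge0 // gamma_ge0.
  + by apply: psi_weights_sum1 sumB => // j _ gx0; rewrite /b gx0 mulr0.
- case=> m [a [w [/fin_all_exists[x wE] a_ge0 _ sumA]]] N ltdN.
  have [kappa0 kappa01] : exists kappa : weighted_knot R Omega N,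
      knot_mx phi kappa = 1%:M.
    apply: (exists_knot_mx1 (s := [seq (a j, x j) | j <- enum 'I_m])) => //.
    + by rewrite (leq_trans _ ltdN) ?leq_addr.
    + by rewrite all_map; apply/allP => j _; apply: a_ge0.
    + rewrite /weighted_sum big_map big_enum /= sumA.
      by apply: eq_bigr => j _; rewrite wE.
  have det_knot kappa := det_knot_mx_le1 phi kappa n_gt0 (N := N).
  split.
    by exists kappa0 => kappa; rewrite kappa01 det1 det_knot.
  move=> kappa /(_ kappa0); rewrite kappa01 det1 => det_ge1.
  by apply/eqP; rewrite -(ge_leif (det_knot kappa)).
- case/(_ _ (leqnn _)) => -[kappa maxkappa] /(_ _ maxkappa) knot1.
  exists (\dim (lin_span (dyads phi)) + 1)%N,
    (fun j => weight kappa j * omega phi (node kappa j)),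
    (fun j => phi (node kappa j) *m adjoint (phi (node kappa j))); split.
  + by move=> j; exists (node kappa j).
  + by move=> j; rewrite mulr_ge0 ?omega_ge0 // ltW // weight_gt0.
  + rewrite -knot1; apply: eq_bigr => j _.
    by rewrite psi_dyad scalerA -rmorphM.
Qed.
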